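(* Let $\{Y_\alpha,\alpha\in A\}$ be a family of random variables with a $(\Psi,\mathbf{C})$ weighted dependency graph $\tilde L$. Fix a positive integer $m$ and consider the $m$-th power $\tilde L^m$ of $\tilde L$. Assume that $\Psi$ is super-multiplicative (with nonnegative values). For $I\in\mathrm{MSet}_{\le m}(A)$ set $Y_I=\prod_{\alpha\in I}Y_\alpha$. Then $\tilde L^m$ is a $(\boldsymbol{\Psi},\mathbf{D}_m)$ weighted dependency graph for the family $\{Y_I,\ I\in\mathrm{MSet}_{\le m}(A)\}$, where $$\boldsymbol{\Psi}(\{I_1,\dots,I_r\})=\Psi(I_1\uplus\cdots\uplus I_r)$$ and $\mathbf{D}_m=(D_{m,r})_{r\ge1}$ is a sequence of positive reals in which $D_{m,r}$ depends only on $m$, $r$, $C_1,\dots,C_{mr}$.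
   Context: All multisets are finite and nonempty; $|B|$ is the number of elements of $B$ counted with multiplicity, $\uplus$ is disjoint union of multisets (multiplicities add), and products over a multiset are taken with multiplicity. $\mathrm{MSet}_{\le m}(A)$ is the set of multisets $I$ of elements of $A$ with $|I|\le m$. A function $\Psi$ on multisets is super-multiplicative if $\Psi(B_1\uplus B_2)\ge\Psi(B_1)\Psi(B_2)$ for all multisets $B_1,B_2$. The joint cumulant of random variables $X_1,\dots,X_r$ with finite moments is $\kappa(X_1,\dots,X_r)=\sum_{\pi}(-1)^{\#(\pi)-1}(\#(\pi)-1)!\prod_{C\in\pi}\mathbb{E}\big(\prod_{i\in C}X_i\big)$, the sum being over set partitions $\pi$ of $\{1,\dots,r\}$; it is symmetric, so $\kappa(Y_\alpha;\alpha\in B)$ makes sense for a multiset $B$. A weighted graph $\tilde L$ is a finite simple graph with a weight in $[0,1]$ on each edge. For a multiset $B$ of vertices, the induced weighted graph $\tilde L[B]$ has one vertex for each element of $B$ counted with multiplicity; two vertices are joined if the corresponding vertices of $\tilde L$ are equal (then the edge has weight $1$) or joined by an edge in $\tilde L$ (then the edge has the weight of that edge). For a weighted graph $K$, $\mathcal{M}(K)$ is the maximum over spanning trees of $K$ of the product of the edge weights of the tree ($1$ if $K$ has one vertex, $0$ by convention if $K$ is disconnected). For multisets $I,J$ of vertices of $\tilde L$, $W(I,J)$ is the maximal weight of an edge connecting a vertex of $I$ and a vertex of $J$, with $W(I,J)=1$ if $I\cap J\neq\emptyset$ and $W(I,J)=0$ if they are disjoint and no edge joins them. The $m$-th power $\tilde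 L^m$ is the weighted graph with vertex set $\mathrm{MSet}_{\le m}(A)$ in which $I$ and $J$ are linked by an edge, of weight $W(I,J)$, unless $I$ and $J$ are disjoint and no edge of $\tilde L$ joins an element of $I$ to an element of $J$. Given a sequence $\mathbf{C}=(C_1,C_2,\dots)$ of positive reals and a function $\Psi$ on multisets of elements of $A$, a weighted graph $\tilde L$ with vertex set $A$ is a $(\Psi,\mathbf{C})$ weighted dependency graph for a family $\{Y_\alpha,\alpha\in A\}$ of random variables (with finite moments, defined on the same probability space) if, for any $r\ge1$ and any multiset $B=\{\alpha_1,\dots,\alpha_r\}$ of elements of $A$, $|\kappa(Y_\alpha;\alpha\in B)|\le C_r\,\Psi(B)\,\mathcal{M}(\tilde L[B])$. The same definition is applied with $A$ replaced by $\mathrm{MSet}_{\le m}(A)$. *)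

(* Defs.v *)
From HB Require Import structures.
From mathcomp Require Import all_boot all_order all_algebra.
From mathcomp Require Import finmap multiset.
From mathcomp Require Import all_classical all_reals all_analysis.
From mathcomp Require Import measurable_realfun.

Set Implicit Arguments.
Unset Strict Implicit.
Unset Printing Implicit Defensive.

Import Order.TTheory GRing.Theory Num.Theory.

Local Open Scope ring_scope.
Local Open Scope mset_scope.

Definition mset_size (V : choiceType) (B : {mset V}) : nat :=
  size (enum_mset B).

(* Multisets are nonempty by convention, hence the lower bound. *)
Record mset_le (m : nat) (A : finType) := MsetLe {
  mset_of_le :> {mset A};
  mset_le_size : (0 < mset_size mset_of_le <= m)%N }.

HB.instance Definition _ m A := [isSub for @mset_of_le m A].
HB.instance Definition _ m A := [Choice of mset_le m A by <:].

Section MsetLeFinite.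
Context (m : nat) (A : finType).

Let encode (I : mset_le m A) : {ffun A -> 'I_m.+1} :=
  [ffun x => inord (mset_of_le I x)].

Let decode (f : {ffun A -> 'I_m.+1}) : option (mset_le m A) :=
  insub (seq_mset (flatten [seq nseq (f x) x | x <- enum A])).

Fact mset_le_codeK : pcancel encode decode.
Proof.
have bnd (I : mset_le m A) x : (mset_of_le I x < m.+1)%N.
  rewrite ltnS -count_mem_mset; apply: leq_trans (count_size _ _) _.
  by case/andP: (mset_le_size I).
move=> I; rewrite /decode; have -> : seq_mset (flatten [seq nseq (encode I x) x
    | x <- enum A]) = mset_of_le I; last exact: (valK I).
apply/msetP => x; rewrite mset_seqE count_flatten -map_comp sumn_map.
rewrite big_enum /= (bigD1 x) //= big1 => [|y yx]; last first.
  by rewrite count_nseq /= (negbTE yx).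
by rewrite count_nseq /= eqxx mul1n addn0 ffunE inordK.
Qed.

HB.instance Definition _ :=
  Choice_isCountable.Build (mset_le m A) (pcan_pickleK mset_le_codeK).
HB.instance Definition _ :=
  fintype.isFinite.Build (mset_le m A) (pcan_enumP mset_le_codeK).

End MsetLeFinite.

Section Cumulants.
Context d (T : measurableType d) (R : realType) (P : probability T R).

(* [fine] is harmless here: it is only applied to expectations of variables
   with finite moments. *)
Definition joint_cumulant (I : finType) (X : I -> {RV P >-> R}) : R :=
  \sum_(pi : {set {set I}} | finset.partition pi [set: I])
    (-1) ^+ #|pi|.-1 * (#|pi|.-1)`!%:R *
    \prod_(C in pi) fine 'E_P[\prod_(i in C) (X i : {mfun T >-> R})]%E.

Definition has_finite_moments (X : {RV P >-> R}) : Prop :=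
  forall n : nat, P.-integrable setT (EFin \o (fun t => X t ^+ n)).

(* The elements of [B], repeated according to multiplicity, are indexed by
   ['I_(mset_size B)]; the order is irrelevant as cumulants are symmetric. *)
Definition mset_nth (V : choiceType) (B : {mset V}) (i : 'I_(mset_size B)) : V :=
  tnth (in_tuple (enum_mset B)) i.

Definition mset_cumulant (V : choiceType) (Y : V -> {RV P >-> R})
  (B : {mset V}) : R := joint_cumulant (fun i => Y (@mset_nth V B i)).

End Cumulants.

Section WeightedGraphs.
Context (R : realType).

(* Only the weights of actual edges are meaningful. *)
Record wgraph (V : finType) := WGraph {
  edge : rel V;
  weight : V -> V -> R;
  edge_sym : symmetric edge;
  edge_irr : irreflexive edge;
  weight_sym : forall x y, edge x y -> weight x y = weight y x;
  weight_itv : forall x y, edge x y -> 0 <= weight x y <= 1 }.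

Section SpanningTrees.
Context (V : finType) (K : wgraph V).

Definition edge_set : {set {set V}} :=
  [set [set x; y] | x in V, y in V & edge K x y].

(* For an edge [e = {x, y}] both maxima range over values equal to
   [weight K x y], see [edge_weightE]. *)
Definition edge_weight (e : {set V}) : R :=
  \big[Num.max/0]_(x in e) \big[Num.max/0]_(y in e | edge K x y) weight K x y.

Definition subgraph_rel (F : {set {set V}}) : rel V :=
  [rel x y | (x != y) && ([set x; y] \in F)].

Definition acyclic (e : rel V) : Prop :=
  forall p : seq V, (2 < size p)%N -> ~~ ucycleb e p.

Definition spanning_tree (F : {set {set V}}) : Prop :=
  [/\ F \subset edge_set,
      forall x y, connect (subgraph_rel F) x y &
      acyclic (subgraph_rel F)].

(* Weights being nonnegative, the default value 0 only matters when [K] has no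
   spanning tree. *)
Definition max_tree_weight : R :=
  \big[Num.max/0]_(F : {set {set V}} | `[< spanning_tree F >])
    \prod_(e in F) edge_weight e.

Lemma edge_weightE x y : edge K x y -> edge_weight [set x; y] = weight K x y.
Proof.
move=> xy; have [w0 _] := andP (weight_itv xy).
apply/le_anti/andP; split.
  apply: bigmax_le => // a; rewrite !inE => aE; apply: bigmax_le => // b.
  rewrite !inE => /andP[bE]; move: aE bE.
  by case/orP=> /eqP-> /orP[]/eqP->; rewrite ?edge_irr // => /weight_sym ->.
apply: (bigmax_sup x); first by rewrite !inE eqxx.
by apply: (bigmax_sup y) => //; rewrite !inE eqxx orbT.
Qed.

End SpanningTrees.

Section InducedGraph.
Context (V : finType) (L : wgraph V) (B : {mset V}).

Let v (i : 'I_(mset_size B)) : V := mset_nth i.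

Definition induced_edge : rel 'I_(mset_size B) :=
  [rel i j | (i != j) && ((v i == v j) || edge L (v i) (v j))].

Definition induced_weight (i j : 'I_(mset_size B)) : R :=
  if v i == v j then 1 else weight L (v i) (v j).

Fact induced_edge_sym : symmetric induced_edge.
Proof. by move=> i j; rewrite /induced_edge /= (eq_sym i) (eq_sym (v i)) edge_sym. Qed.

Fact induced_edge_irr : irreflexive induced_edge.
Proof. by move=> i; rewrite /induced_edge /= eqxx. Qed.

Fact induced_weight_sym i j :
  induced_edge i j -> induced_weight i j = induced_weight j i.
Proof.
rewrite /induced_weight /= (eq_sym (v j)) => /andP[_].
by case: eqP => //= _; apply: weight_sym.
Qed.

Fact induced_weight_itv i j : induced_edge i j -> 0 <= induced_weight i j <= 1.
Proof.
rewrite /induced_weight /= => /andP[_].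
by case: eqP => /= [_ _|_]; [rewrite ler01 lexx | apply: weight_itv].
Qed.

Definition induced_wgraph : wgraph 'I_(mset_size B) :=
  WGraph induced_edge_sym induced_edge_irr induced_weight_sym
    induced_weight_itv.

End InducedGraph.

Section PowerGraph.
Context (A : finType) (L : wgraph A).

Definition mset_weight (I J : {mset A}) : R :=
  if mdisjoint I J
  then \big[Num.max/0]_(x in I) \big[Num.max/0]_(y in J | edge L x y)
         weight L x y
  else 1.

Definition mset_linked (I J : {mset A}) : bool :=
  ~~ mdisjoint I J || [exists x in I, exists y in J, edge L x y].

Lemma mdisjointC (I J : {mset A}) : mdisjoint I J = mdisjoint J I.
Proof. by rewrite /mdisjoint msetIC. Qed.

Lemma mset_linkedC : symmetric mset_linked.
Proof.
move=> I J; rewrite /mset_linked mdisjointC; congr (_ || _).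
apply/idP/idP => /exists_inP[x xI /exists_inP[y yJ xy]];
  by apply/exists_inP; exists y => //; apply/exists_inP; exists x => //;
     rewrite edge_sym.
Qed.

Lemma mset_weight_itv I J : 0 <= mset_weight I J <= 1.
Proof.
rewrite /mset_weight; case: ifP => _; last by rewrite ler01 lexx.
apply/andP; split; first exact: bigmax_ge_id.
by apply: bigmax_le => // x _; apply: bigmax_le => // y /andP[_ /weight_itv/andP[]].
Qed.

Lemma mset_weightC I J : mset_weight I J = mset_weight J I.
Proof.
rewrite /mset_weight mdisjointC; case: ifP => // _.
have le (H K : {mset A}) :
    \big[Num.max/0]_(x in H) \big[Num.max/0]_(y in K | edge L x y) weight L x y
 <= \big[Num.max/0]_(x in K) \big[Num.max/0]_(y in H | edge L x y) weight L x y.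
  apply: bigmax_le => [|x xH]; first exact: bigmax_ge_id.
  apply: bigmax_le => [|y /andP[yK xy]]; first exact: bigmax_ge_id.
  apply: (bigmax_sup y) => //; apply: (bigmax_sup x); first by rewrite xH edge_sym.
  by rewrite (weight_sym xy).
by apply/le_anti; rewrite !le.
Qed.

Section Power.
Context (m : nat).

Definition power_edge : rel (mset_le m A) :=
  [rel I J : mset_le m A | (I != J) && mset_linked I J].

Definition power_weight (I J : mset_le m A) : R := mset_weight I J.

Fact power_edge_sym : symmetric power_edge.
Proof. by move=> I J; rewrite /power_edge /= eq_sym mset_linkedC. Qed.

Fact power_edge_irr : irreflexive power_edge.
Proof. by move=> I; rewrite /power_edge /= eqxx. Qed.

Fact power_weight_sym I J :
  power_edge I J -> power_weight I J = power_weight J I.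
Proof. by move=> _; apply: mset_weightC. Qed.

Fact power_weight_itv I J : power_edge I J -> 0 <= power_weight I J <= 1.
Proof. by move=> _; apply: mset_weight_itv. Qed.

Definition power_wgraph : wgraph (mset_le m A) :=
  WGraph power_edge_sym power_edge_irr power_weight_sym power_weight_itv.

End Power.
End PowerGraph.
End WeightedGraphs.

Section WeightedDependencyGraphs.
Context d (T : measurableType d) (R : realType) (P : probability T R).

(* [Psi] at [mset0] and [C 0] play no role. *)
Definition weighted_dependency_graph (V : finType) (Psi : {mset V} -> R)
    (C : nat -> R) (Y : V -> {RV P >-> R}) (L : wgraph R V) : Prop :=
  (forall v, has_finite_moments (Y v)) /\
  (forall B : {mset V}, B != mset0 ->
     `|mset_cumulant Y B| <=
       C (mset_size B) * Psi B * max_tree_weight (induced_wgraph L B)).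

Definition super_multiplicative (V : finType) (Psi : {mset V} -> R) : Prop :=
  forall B1 B2 : {mset V}, B1 != mset0 -> B2 != mset0 ->
    Psi B1 * Psi B2 <= Psi (B1 `+` B2).

Definition mset_product (A : finType) (Y : A -> {RV P >-> R}) (m : nat)
  (I : mset_le m A) : {RV P >-> R} :=
  \prod_(x <- enum_mset I) (Y x : {mfun T >-> R}).

Definition bold_Psi (A : finType) (Psi : {mset A} -> R) (m : nat)
  (B : {mset mset_le m A}) : R :=
  Psi (\big[msetD/mset0]_(I <- enum_mset B) mset_of_le I).

End WeightedDependencyGraphs.

(* Main.v *)
Require Import Defs.
From HB Require Import structures.
From mathcomp Require Import all_boot all_order all_algebra.
From mathcomp Require Import finmap multiset.
From mathcomp Require Import all_classical all_reals all_analysis.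
From mathcomp Require Import measurable_realfun lra.
From mathcomp Require Import fintype finset.

(** The cumulant of the products [Y_I] is expanded into cumulants of the [Y_a]
    by the formula of Leonov and Shiryaev ([grouped_cumulant]).  Take one index
    for each copy of an element of [A] in one of [I_1, ..., I_r] ([copies]), so
    that [I_1, ..., I_r] are the fibers of a map onto ['I_r].  Then
    [kappa(Y_(I_1), ..., Y_(I_r))] is the sum, over the partitions [rho] of the
    copies whose blocks connect all the fibers, of the products of the cumulants
    [kappa(Y_a; a in D)] for [D] in [rho].  The hypothesis bounds each factor by
    [C_#|D| * Psi(D) * M(D)], where [M(D)] is the maximal weight of a spanning
    tree of the graph induced on [D].  In the product over the blocks of [rho]:

    - the constants are at most a power of [1 + C_1 + ... + C_(m r)], and the
      number of partitions is bounded in terms of [m r];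
    - super-multiplicativity bounds the product of the [Psi(D)] by
      [Psi(I_1 + ... + I_r)], the disjoint union of the blocks being that of the
      [I_j];
    - optimal spanning trees of all the blocks, projected to ['I_r], together
      form a connected multigraph because [rho] connects the fibers.  Projection
      does not decrease the weight of an edge whose ends stay distinct, by the
      definition of the power graph, and removing loops and repeated or
      redundant edges does not decrease a product of weights in [0, 1].  What
      remains is a spanning tree, so the product of the [M(D)] is at most the
      maximal tree weight of the power graph ([prod_block_tree_weight]).

    The formula of Leonov and Shiryaev is a statement about set functions: any
    [M] with [M set0 = 1] is [M S = \sum_(rho partition of S) \prod_(D in rho) k D]
    for some [k], found by solving for the one-block partition
    ([cluster_sum_exists]).  Substituting this in the signed sum that defines
    cumulants and exchanging sums leaves, for each [rho], the sum of
    [(-1)^(n-1) (n-1)!] over the [n]-block partitions coarser than a given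
    family of sets; it is 1 if the family is connected and 0 otherwise
    ([sum_moebius_coarser]).  Applied to an injection instead of a fibration, the
    same formula identifies [k] with the cumulant ([cumulant_cluster]). *)

Set Implicit Arguments.
Unset Strict Implicit.
Unset Printing Implicit Defensive.

Import Order.TTheory GRing.Theory Num.Theory.

Local Open Scope ring_scope.
Local Open Scope mset_scope.

(** * Alternating sums over coarsenings of a family of sets *)

Section Coarsenings.
Context (R : comNzRingType) (J : finType).
Implicit Types (H P : {set {set J}}) (C Q S : {set J}).

(** The Moebius function of the partition lattice between a partition into [k]
    blocks and the one-block partition. *)
Definition moebius (k : nat) : R := (-1) ^+ k.-1 * (k.-1)`!%:R.

Definition coarser H P := [forall h in H, exists C in P, h \subset C].
Definition splits H Q := [forall h in H, (h \subset Q) || [disjoint h & Q]].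
Definition connected_by H :=
  [forall Q : {set J}, splits H Q ==> (Q == set0) || (Q == setT)].

Lemma moebius_recr k : (0 < k)%N -> moebius k.+1 + k%:R * moebius k = 0.
Proof.
case: k => // k _; rewrite /moebius /= factS natrM exprS.
by rewrite [k.+1%:R * (_ ^+ _ * _)]mulrCA mulN1r mulNr addNr.
Qed.

(** Two blocks of a partition are disjoint, so a set of [H] contained in some
    block either lies in [C] or avoids it. *)
Lemma block_splits H P C : trivIset P -> coarser H P -> C \in P -> splits H C.
Proof.
move=> tP /forall_inP HP CP; apply/forall_inP => h /HP/exists_inP[C' C'P hC'].
have [<-|CC'] := eqVneq C' C; first by rewrite hC'.
apply/orP; right; apply: (disjointWl hC').
by move/trivIsetP: tP; apply.
Qed.

(** When [H] is disconnected, take a minimal nonempty set [Q] that splits it.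
    Minimality puts [Q] inside one block of every partition coarser than [H].
    Such partitions are thus of two kinds: those having [Q] as a block, and those
    obtained from one of the former by merging [Q] into one of the other
    blocks.  A partition of the first kind with [k + 1] blocks gives [k] of the
    second kind with [k] blocks, and [moebius_recr] makes these terms cancel. *)
Section Split.
Context (H : {set {set J}}) (Q : {set J}) (q : J).
Hypotheses (qQ : q \in Q) (QT : Q != setT) (splitsQ : splits H Q).
Hypothesis minQ : forall Q', splits H Q' -> Q' \subset Q -> Q' != set0 -> Q' = Q.

Definition good P := partition P setT && coarser H P.

(** The trace on [Q] of the block of [q] also splits [H], hence is all of [Q]. *)
Let Q_block P : good P -> Q \subset pblock P q /\ pblock P q \in P.
Proof.
move=> /andP[pP HP]; have tP := partition_trivIset pP.
have CP : pblock P q \in P by rewrite pblock_mem // (cover_partition pP).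
split=> //; apply/setIidPr; apply: minQ; last 1 first.
- apply/set0Pn; exists q; rewrite inE qQ mem_pblock (cover_partition pP) inE //.
- apply/forall_inP => h hH; have /forall_inP/(_ h hH) := splitsQ.
  have /forall_inP/(_ h hH) := block_splits tP HP CP.
  case/orP=> [hC|dC]; last first.
    by move=> _; rewrite (disjointWr _ dC) ?orbT // subsetIl.
  case/orP=> [hQ|dQ]; first by rewrite subsetI hC hQ.
  by rewrite (disjointWr _ dQ) ?orbT // subsetIr.
- exact: subsetIr.
Qed.

Definition merge P C := (C :|: Q) |: (P :\ Q :\ C).
(** The inverse of [merge]; the second component is the block that had
    absorbed [Q]. *)
Definition split_off P :=
  (Q |: ((pblock P q :\: Q) |: (P :\ pblock P q)), pblock P q :\: Q).

Let merge_facts P C : good P -> Q \in P -> C \in P -> C != Q ->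
  [/\ good (merge P C), Q \notin merge P C, split_off (merge P C) = (P, C) &
      #|merge P C| = #|P|.-1].
Proof.
move=> /andP[pP HP] QP CP CQ; have tP := partition_trivIset pP.
have P0 D : D \in P -> D != set0 by exact: partition_neq0 pP.
have dP D D' : D \in P -> D' \in P -> D != D' -> [disjoint D & D'].
  by move: D D'; apply/trivIsetP.
have C0 := P0 _ CP.
have CP' : C \in P :\ Q by rewrite !inE CQ.
have pPQ := partitionD1 pP QP.
have pPQC := partitionD1 pPQ CP'.
have CU : (C :|: Q) \notin P :\ Q :\ C.
  apply/negP; rewrite !inE => /and3P[h1 h2 h3].
  have := dP _ _ h3 QP h2; rewrite disjoint_sym => /disjoint_setI0/setP/(_ q).
  by rewrite !inE qQ orbT.
have pM : partition (merge P C) setT.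
  have -> : [set: J] = (C :|: Q) :|: (setT :\: Q :\: C).
    by apply/setP=> x; rewrite !inE; case: (x \in C); case: (x \in Q).
  apply: partitionU1 => //; first by apply/set0Pn; exists q; rewrite !inE qQ orbT.
  rewrite -setI_eq0; apply/eqP/setP=> x; rewrite !inE.
  by case: (x \in C); case: (x \in Q).
have MC : C :|: Q \in merge P C by rewrite !inE eqxx.
have pb : pblock (merge P C) q = C :|: Q.
  by apply: def_pblock => //; [exact: partition_trivIset pM|rewrite inE qQ orbT].
have CmQ : (C :|: Q) :\: Q = C.
  rewrite setDUl setDv setU0; apply/setDidPl; exact: dP.
split.
- rewrite /good pM; apply/forall_inP => h /(forall_inP HP)/exists_inP[D DP hD].
  apply/exists_inP; have [DQ|DQ] := eqVneq D Q.
    by exists (C :|: Q) => //; rewrite (subset_trans hD) // DQ subsetUr.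
  have [DC|DC] := eqVneq D C.
    by exists (C :|: Q) => //; rewrite (subset_trans hD) // DC subsetUl.
  by exists D => //; rewrite !inE DC DQ DP orbT.
- rewrite !inE eqxx andbF orbF; apply/eqP => QC.
  have := dP _ _ CP QP CQ.
  by rewrite -setI_eq0 (setIidPl _) ?(negbTE C0) // QC subsetUl.
- rewrite /split_off pb CmQ; congr pair.
  rewrite /merge setU1K // setD1K // setD1K //.
- by rewrite cardsU1 CU (cardsD1 Q P) QP (cardsD1 C (P :\ Q)) CP'.
Qed.

Let split_facts P P1 C : good P -> Q \notin P -> split_off P = (P1, C) ->
  [/\ good P1, Q \in P1, C \in P1, C != Q & merge P1 C = P].
Proof.
move=> gP QP; have [QB BP] := Q_block gP; move: gP => /andP[pP HP].
have tP := partition_trivIset pP; rewrite /split_off; set B := pblock P q in QB BP *.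
case=> <- <-{P1 C}.
have BQ : B != Q by apply: contraNneq QP => <-.
have B0 : B :\: Q != set0.
  by apply: contra BQ; rewrite setD_eq0 => BQ; rewrite eqEsubset BQ QB.
have dP D : D \in P :\ B -> [disjoint D & B].
  by rewrite inE => /andP[DB DP]; apply: (trivIsetP tP) => //; rewrite inE in DB.
have nP D : D != set0 -> D \subset B -> D \notin P :\ B.
  move=> D0 DB; apply/negP => /dP; rewrite -setI_eq0 => /eqP E.
  by move: D0; rewrite -(setIidPl DB) E eqxx.
have Q0 : Q != set0 by apply/set0Pn; exists q.
have CQ : B :\: Q != Q.
  by apply/eqP => /setP/(_ q); rewrite !inE qQ.
have p1 := partitionD1 pP BP.
have p2 : partition ((B :\: Q) |: (P :\ B)) (~: Q).
  have -> : ~: Q = (B :\: Q) :|: (setT :\: B).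
    apply/setP => x; rewrite !inE andbT; have := subsetP QB x.
    by case: (x \in Q) => [->|_] //=; case: (x \in B).
  apply: partitionU1 => //; rewrite -setI_eq0; apply/eqP/setP=> x.
  by rewrite !inE; case: (x \in B); rewrite ?andbF.
have p3 : partition (Q |: ((B :\: Q) |: (P :\ B))) setT.
  rewrite -(setUCr Q); apply: partitionU1 => //.
  by rewrite -setI_eq0 setICr.
split.
- rewrite /good p3; apply/forall_inP => h hH.
  have /exists_inP[D DP hD] := forall_inP HP h hH.
  apply/exists_inP; have /orP[hQ|hQ] := forall_inP splitsQ h hH.
    by exists Q => //; rewrite !inE eqxx.
  have [DB|DB] := eqVneq D B; last by exists D => //; rewrite !inE DB DP !orbT.
  exists (B :\: Q); first by rewrite !inE eqxx orbT.
  by rewrite subsetD -DB hD.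
- by rewrite !inE eqxx.
- by rewrite !inE eqxx orbT.
- by [].
- rewrite /merge setU1K; last first.
    by rewrite inE negb_or nP // inE eq_sym CQ.
  rewrite setU1K; last by rewrite nP // subDset subsetUr.
  by rewrite setUC (setUC (_ :\: _)) -{1}(setIidPr QB) setID setUC setD1K.
Qed.

Lemma sum_moebius_split :
  \sum_(P : {set {set J}} | partition P setT && coarser H P) moebius #|P| = 0.
Proof.
rewrite (bigID (fun P => Q \in P)) /=.
rewrite [X in _ + X](reindex_onto
  (fun pc : {set {set J}} * {set J} => merge pc.1 pc.2) split_off) /=; last first.
  by move=> P /andP[gP QP]; case: (split_facts gP QP erefl).
rewrite (eq_bigl (fun pc : {set {set J}} * {set J} =>
   (good pc.1 && (Q \in pc.1)) && (pc.2 \in pc.1 :\ Q))); last first.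
  move=> [P C] /=; apply/idP/idP.
    case/andP=> /andP[gM QM] /eqP sM.
    by have [-> -> CP CQ _] := split_facts gM QM sM; rewrite !inE CP CQ.
  case/andP=> /andP[gP QP] /setD1P[CQ CP].
  have [/andP[pM cM] nQ sM _] := merge_facts gP QP CP CQ.
  by rewrite sM eqxx pM cM nQ.
rewrite -(pair_big_dep (fun P => good P && (Q \in P)) (fun P C => C \in P :\ Q)
  (fun P C => moebius #|merge P C|)) /= -big_split /=.
apply: big1 => P /andP[gP QP].
rewrite (eq_bigr (fun=> moebius #|P|.-1)); last first.
  move=> C; rewrite !inE => /andP[CQ CP].
  by have [_ _ _ ->] := merge_facts gP QP CP CQ.
rewrite sumr_const -mulr_natl (cardsD1 Q P) QP /=; apply: moebius_recr.
(* [Q] is not the only block, as it is not the whole set. *)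
rewrite card_gt0; apply: contra QT => /eqP P0.
have /andP[pP _] := gP; rewrite -(cover_partition pP).
by rewrite -(setD1K QP) P0 setU0 /cover big_set1.
Qed.

End Split.

(** If [H] is connected, every block of a coarser partition splits [H] and so is
    the whole set: the only term is the one-block partition.  Otherwise the sum
    vanishes by [sum_moebius_split]. *)
Lemma sum_moebius_coarser H : (0 < #|J|)%N ->
  \sum_(P : {set {set J}} | partition P setT && coarser H P) moebius #|P| =
  (connected_by H)%:R.
Proof.
rewrite -cardsT card_gt0 => J0; case: (boolP (connected_by H)) => [cH|].
  rewrite (big_pred1 [set setT]) ?cards1 ?/moebius ?expr0 ?mul1r // => P.
  apply/idP/eqP => [/andP[pP HP]|->]; last first.
    rewrite /partition /cover big_set1 eqxx inE eq_sym J0 andbT /=; apply/andP; split.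
      by rewrite /trivIset /cover !big_set1.
    by apply/forall_inP => h _; apply/exists_inP; exists setT; rewrite ?inE ?subsetT.
  have PT C : C \in P -> C = setT.
    move=> CP; have := forallP cH C.
    rewrite (block_splits (partition_trivIset pP) HP CP) /=.
    by rewrite (negbTE (partition_neq0 pP CP)) => /eqP.
  apply/setP => C; rewrite inE; apply/idP/eqP => [/PT//|->].
  have [q _] := set0Pn _ J0; have := cover_partition pP => /setP/(_ q).
  by rewrite inE => /bigcupP[D DP _]; rewrite -(PT _ DP).
case/forallPn=> Q0; rewrite negb_imply negb_or => /and3P[sQ0 Q00 Q0T].
pose pr Q := splits H Q && (Q != set0).
have prQ0 : pr Q0 by rewrite /pr sQ0.
have [Q /minsetP[/andP[sQ Qn0] minQ] QQ0] := minset_exists prQ0.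
have [q qQ] := set0Pn _ Qn0.
apply: (@sum_moebius_split H Q q) => //.
  by apply: contra Q0T => /eqP QT; rewrite -subTset -QT.
by move=> Q' sQ' sub Q'0; apply: minQ => //; apply/andP.
Qed.

End Coarsenings.

(** * Joint moments, cumulants and grouping of variables *)

(** If [k] gives joint cumulants then [cluster_sum k] gives joint moments. *)
Definition cluster_sum (R : comNzRingType) (I : finType) (k : {set I} -> R)
    (S : {set I}) : R :=
  \sum_(rho : {set {set I}} | partition rho S) \prod_(D in rho) k D.

(** Grouping along a partial map covers two uses: merging variables along a
    total map, and restricting to a subfamily along the partial inverse of an
    injection. *)
Section Grouping.
Context (R : comNzRingType) (I J : finType) (f : I -> option J).
Implicit Types (C : {set J}) (D : {set I}) (P : {set {set J}}).

Definition opreim C : {set I} := [set x | if f x is Some j then j \in C else false].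
Definition oimg D : {set J} := [set j | [exists x in D, f x == Some j]].

Lemma opreim_subset C C' : C \subset C' -> opreim C \subset opreim C'.
Proof.
move=> CC; apply/subsetP => x; rewrite !inE.
by case: (f x) => // j; apply: (subsetP CC).
Qed.

Lemma subset_opreim D C :
  D \subset opreim setT -> (D \subset opreim C) = (oimg D \subset C).
Proof.
move=> DT; apply/subsetP/subsetP => [DC j|DC x xD].
  by rewrite inE => /exists_inP[x /DC]; rewrite inE; case: (f x) => // j' jC /eqP[<-].
have := subsetP DT x xD; rewrite !inE; case fx: (f x) => [j|] // _.
by apply: DC; rewrite inE; apply/exists_inP; exists x => //; rewrite fx.
Qed.

Lemma opreim_disjoint C C' : [disjoint C & C'] -> [disjoint opreim C & opreim C'].
Proof.
rewrite -!setI_eq0 => /eqP/setP CC; apply/eqP/setP => x; rewrite !inE.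
by case: (f x) => // j; have := CC j; rewrite !inE.
Qed.

Lemma opreim_cover P : \bigcup_(C in P) opreim C = opreim (cover P).
Proof.
apply/setP => x; apply/bigcupP/idP => [[C CP]|]; rewrite !inE;
  case fx: (f x) => [j|] //.
  by move=> jC; apply/bigcupP; exists C.
by case/bigcupP => C CP jC; exists C => //; rewrite inE fx.
Qed.

(** Partitions [rho] of the preimage of the whole set whose blocks each lie over
    a block of [P] correspond to families of partitions of the preimages of the
    blocks of [P]: [restr] and [glue] are the two directions. *)
Section Distribute.
Context (P : {set {set J}}) (pP : partition P setT).

Let restr (rho : {set {set I}}) : {ffun {set J} -> {set {set I}}} :=
  [ffun C => if C \in P then [set D in rho | D \subset opreim C] else set0].
Let glue (g : {ffun {set J} -> {set {set I}}}) := \bigcup_(C in P) g C.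
Let finer rho := partition rho (opreim setT) && coarser [set oimg D | D in rho] P.

Let finerP rho : finer rho ->
  forall D, D \in rho -> exists2 C, C \in P & D \subset opreim C.
Proof.
case/andP=> pr /forall_inP H D Dr.
have /exists_inP[C CP DC] := H _ (imset_f _ Dr).
by exists C => //; rewrite subset_opreim // (partitionS pr).
Qed.

Let dP C C' x : C \in P -> C' \in P -> x \in opreim C -> x \in opreim C' -> C = C'.
Proof.
move=> CP C'P xC xC'; apply/eqP/negPn/negP.
move/(trivIsetP (partition_trivIset pP) _ _ CP C'P).
by move/opreim_disjoint/disjoint_setI0/setP/(_ x); rewrite in_setI in_set0 xC xC'.
Qed.

Let restr_part rho C : finer rho -> C \in P ->
  partition [set D in rho | D \subset opreim C] (opreim C).
Proof.
move=> gr CP; have /andP[pr _] := gr; apply/and3P; split.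
- apply/eqP/setP => x; apply/bigcupP/idP => [[D]|xC].
    by rewrite inE => /andP[_ /subsetP]; apply.
  have : x \in cover rho.
    by rewrite (cover_partition pr); apply: subsetP xC; rewrite opreim_subset ?subsetT.
  case/bigcupP => D Dr xD; exists D => //; rewrite inE Dr.
  have [C' C'P DC'] := finerP gr Dr.
  by rewrite (dP CP C'P xC) // (subsetP DC').
- apply/trivIsetP => D D'; rewrite !inE => /andP[Dr _] /andP[D'r _].
  by apply: (trivIsetP (partition_trivIset pr)).
- by rewrite inE (partition0 pr).
Qed.

Let glueK g : g \in pfamily set0 (mem P) (fun C rho => partition rho (opreim C)) ->
  finer (glue g) /\ restr (glue g) = g.
Proof.
case/pfamilyP => /subsetP sg pg.
have block C D : C \in P -> D \in g C -> D \subset opreim C.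
  by move=> CP; apply: partitionS; apply: pg.
have blockE C C' D : C \in P -> C' \in P -> D \in g C -> D \subset opreim C' -> C = C'.
  move=> CP C'P DC DC'; have /set0Pn[x xD] := partition_neq0 (pg C CP) DC.
  by apply: (@dP C C' x) => //; [apply: (subsetP (block _ _ CP DC))|apply: (subsetP DC')].
split; last first.
  apply/ffunP => C; rewrite ffunE; case: ifP => CP; last first.
    by apply/esym/eqP/negPn/negP => /(sg C); rewrite /= CP.
  apply/setP => D; rewrite inE; apply/andP/idP => [[/bigcupP[C' C'P DC'] DC]|DC].
    by rewrite -(blockE _ _ _ C'P CP DC' DC).
  by split; [apply/bigcupP; exists C|exact: block CP DC].
apply/andP; split; last first.
  apply/forall_inP => _ /imsetP[D /bigcupP[C CP DC] ->]; apply/exists_inP.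
  exists C => //; rewrite -subset_opreim; first exact: block.
  by rewrite (subset_trans (block _ _ CP DC)) // opreim_subset ?subsetT.
apply/and3P; split.
- apply/eqP; rewrite -(cover_partition pP) -opreim_cover; apply/setP => x.
  apply/bigcupP/bigcupP => [[D /bigcupP[C CP DC] xD]|[C CP]].
    by exists C => //; apply: (subsetP (block _ _ CP DC)).
  rewrite -(cover_partition (pg C CP)) => /bigcupP[D DC xD].
  by exists D => //; apply/bigcupP; exists C.
- apply/trivIsetP => D D' /bigcupP[C CP DC] /bigcupP[C' C'P D'C'].
  have [CC|CC] := eqVneq C C'.
    by rewrite -CC in D'C'; apply: (trivIsetP (partition_trivIset (pg C CP))).
  move=> _; apply: (disjointWl (block _ _ CP DC)).
  apply: (disjointWr (block _ _ C'P D'C')); apply: opreim_disjoint.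
  exact: (trivIsetP (partition_trivIset pP)).
- by apply/bigcupP => -[C CP]; rewrite (partition0 (pg C CP)).
Qed.

Lemma prod_cluster_sum (k : {set I} -> R) :
  \prod_(C in P) cluster_sum k (opreim C) =
  \sum_(rho : {set {set I}} | partition rho (opreim setT) &&
      coarser [set oimg D | D in rho] P) \prod_(D in rho) k D.
Proof.
rewrite (big_distr_big_dep set0) (reindex_onto glue restr) /=; last first.
  move=> rho gr; apply/setP => D; apply/bigcupP/idP => [[C CP]|Dr].
    by rewrite ffunE CP inE => /andP[].
  have [C CP DC] := finerP gr Dr.
  by exists C; rewrite // ffunE CP inE Dr.
apply: eq_big => [g|g gP].
  apply/idP/andP => [/glueK[gr rg]|[gr /eqP <-]].
    by split; [exact: gr|rewrite rg].
  apply/pfamilyP; split=> [|C CP].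
    by apply/subsetP => C; rewrite inE ffunE; case: ifP => //; rewrite eqxx.
  by rewrite ffunE CP unfold_in /=; apply: restr_part.
have [gr rg] := glueK gP.
(* Each [D] in [glue g] lies over exactly one block [C]. *)
transitivity (\prod_(C in P) \prod_(D in glue g | D \subset opreim C) k D).
  apply: eq_bigr => C CP; apply: eq_bigl => D.
  by rewrite -{1}rg ffunE CP inE.
rewrite (exchange_big_dep (mem (glue g))) /=; last by move=> C D _ /andP[].
apply: eq_bigr => D Dg; have [C CP DC] := finerP gr Dg.
rewrite (big_pred1 C) // => C'; rewrite Dg /=; apply/andP/eqP => [[C'P DC']|->//].
have /set0Pn[x xD] : D != set0 by case/andP: gr => pr _; exact: partition_neq0 pr Dg.
by apply: (@dP _ _ x) => //; apply: (subsetP _ x xD).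
Qed.

End Distribute.

(** The formula of Leonov and Shiryaev.  Expanding the product over the blocks of
    [P] and exchanging the sums, the coefficient of a partition [rho] is the
    alternating sum over the partitions coarser than the images of its
    blocks. *)
Lemma grouped_cumulant (k : {set I} -> R) : (0 < #|J|)%N ->
  \sum_(P : {set {set J}} | partition P setT)
     moebius R #|P| * \prod_(C in P) cluster_sum k (opreim C) =
  \sum_(rho : {set {set I}} | partition rho (opreim setT) &&
      connected_by [set oimg D | D in rho]) \prod_(D in rho) k D.
Proof.
move=> J0; under eq_bigr => P pP do rewrite prod_cluster_sum // mulr_sumr.
rewrite (exchange_big_dep (fun rho => partition rho (opreim setT))) /=; last first.
  by move=> P rho _ /andP[].
rewrite [RHS]big_mkcondr /=; apply: eq_bigr => rho pr.
transitivity (\sum_(P : {set {set J}} | partition P setT &&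
    coarser [set oimg D | D in rho] P) moebius R #|P| * \prod_(D in rho) k D).
  by apply: eq_bigl => P; rewrite pr.
rewrite -mulr_suml sum_moebius_coarser //.
by case: connected_by; rewrite ?mul1r ?mul0r.
Qed.

End Grouping.

Section Existence.
Context (R : comNzRingType) (I : finType) (M : {set I} -> R).
Hypothesis M0 : M set0 = 1.

(** The equation [M S = cluster_sum k S] determines [k S] from the values of [k]
    on proper subsets of [S]; [n] bounds the depth of this recursion. *)
Fixpoint cluster_approx (n : nat) (S : {set I}) : R :=
  if n is n'.+1 then
    M S - \sum_(rho : {set {set I}} | partition rho S && (rho != [set S]))
      \prod_(D in rho) cluster_approx n' D
  else 0.

Lemma partition_proper (rho : {set {set I}}) (S D : {set I}) :
  partition rho S -> rho != [set S] -> D \in rho -> D \proper S.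
Proof.
move=> pr rS Dr; rewrite properEneq (partitionS pr) // andbT.
apply: contra rS => /eqP DS; apply/eqP/setP => D'; rewrite inE.
apply/idP/eqP => [D'r|->]; last by rewrite -DS.
apply/eqP/negPn/negP => D'S; rewrite -DS in D'S.
have := trivIsetP (partition_trivIset pr) _ _ D'r Dr D'S.
rewrite -setI_eq0 DS (setIidPl (partitionS pr D'r)).
by rewrite (negbTE (partition_neq0 pr D'r)).
Qed.

Lemma cluster_approx_stable n n' (S : {set I}) :
  (#|S| <= n)%N -> (#|S| <= n')%N -> S != set0 ->
  cluster_approx n S = cluster_approx n' S.
Proof.
elim: n n' S => [|n IH] [|n'] S.
- by [].
- by rewrite leqn0 cards_eq0 => /eqP->; rewrite eqxx.
- by rewrite leqn0 cards_eq0 => _ /eqP->; rewrite eqxx.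
move=> Sn Sn' S0 /=; congr (_ - _); apply: eq_bigr => rho /andP[pr rS].
apply: eq_bigr => D Dr; have pD := partition_proper pr rS Dr.
apply: IH; last exact: partition_neq0 pr Dr.
  by rewrite -ltnS (leq_trans (proper_card pD)).
by rewrite -ltnS (leq_trans (proper_card pD)).
Qed.

Lemma partition1 (S : {set I}) : S != set0 -> partition [set S] S.
Proof.
move=> S0; rewrite /partition /trivIset /cover !big_set1 !eqxx /=.
by rewrite inE eq_sym.
Qed.

Lemma cluster_sum_exists : exists k : {set I} -> R, forall S, M S = cluster_sum k S.
Proof.
exists (cluster_approx #|I|) => S; have [->|S0] := eqVneq S set0.
  rewrite /cluster_sum (big_pred1 set0) ?big_set0 // => rho.
  by rewrite partition_set0.
rewrite /cluster_sum (bigD1 [set S]) ?partition1 //= big_set1.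
have -> : cluster_approx #|I| S = cluster_approx #|I|.+1 S.
  by apply: cluster_approx_stable => //; [exact: max_card|apply: leqW; exact: max_card].
by rewrite [cluster_approx _.+1 S]/= subrK.
Qed.

End Existence.

Section Restriction.
Context (R : comNzRingType) (I J : finType) (h : J -> I) (h_inj : injective h).
Context (k : {set I} -> R).

(** This is [grouped_cumulant] for the partial inverse of [h]: distinct blocks
    have disjoint images under an injective map, so only the one-block partition
    is connected. *)
Lemma cumulant_cluster : (0 < #|J|)%N ->
  \sum_(P : {set {set J}} | partition P setT)
     moebius R #|P| * \prod_(C in P) cluster_sum k (h @: C) = k (h @: setT).
Proof.
move=> J0; pose f x := [pick j | h j == x].
have fh j : f (h j) = Some j.
  by rewrite /f; case: pickP => [j' /eqP/h_inj->|/(_ j)]; rewrite ?eqxx.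
have fE x j : f x = Some j -> h j = x.
  by rewrite /f; case: pickP => // j' /eqP <- [->].
have opreimE C : opreim f C = h @: C.
  apply/setP => x; rewrite inE; apply/idP/imsetP => [|[j jC ->]]; last by rewrite fh.
  by case fx: (f x) => [j|] // jC; exists j; rewrite ?(fE _ _ fx).
have oimgE (C : {set J}) : oimg f (h @: C) = C.
  apply/setP => j; rewrite inE; apply/exists_inP/idP => [[_ /imsetP[j' j'C ->]]|jC].
    by rewrite fh => /eqP[<-].
  by exists (h j); rewrite ?imset_f ?fh.
under eq_bigr => P pP do under eq_bigr => C CP do rewrite -opreimE.
rewrite grouped_cumulant // (big_pred1 [set h @: setT]) ?big_set1 // => rho.
have hT0 : h @: [set: J] != set0 by rewrite -card_gt0 card_imset // cardsT.
rewrite opreimE; apply/andP/eqP => [[pr cr]|->]; last first.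
  split; first exact: partition1.
  rewrite imset_set1 oimgE; apply/forallP => Q; apply/implyP => /forall_inP/(_ setT).
  rewrite inE eqxx subTset => /(_ isT)/orP[->|]; first by rewrite orbT.
  by rewrite -setI_eq0 setTI => ->.
have blk D : D \in rho -> D = h @: setT.
  move=> Dr; have /subsetP DT := partitionS pr Dr.
  have DE : D = h @: oimg f D.
    apply/setP => x; apply/idP/imsetP => [xD|[j]]; last first.
      by rewrite inE => /exists_inP[y yD /eqP/fE hj] ->; rewrite hj.
    have /imsetP[j _ xE] := DT x xD; exists j => //.
    by rewrite inE; apply/exists_inP; exists x => //; rewrite xE fh.
  have /forallP/(_ (oimg f D)) := cr; rewrite [X in X ==> _](_ : _ = true).
    case/orP=> /eqP E; last by rewrite DE E.
    by have := partition_neq0 pr Dr; rewrite DE E imset0 eqxx.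
  apply/forall_inP => _ /imsetP[D' D'r ->].
  have [->|DD] := eqVneq D' D; first by rewrite subxx.
  apply/orP; right; have := trivIsetP (partition_trivIset pr) _ _ D'r Dr DD.
  rewrite -!setI_eq0 => /eqP/setP E; apply/eqP/setP => j; rewrite !inE.
  apply/negP => /andP[/exists_inP[x xD' /eqP/fE jx] /exists_inP[y yD /eqP/fE jy]].
  by have := E x; rewrite !inE xD' -jx jy yD.
apply/setP => D; rewrite inE; apply/idP/eqP => [/blk//|->].
have /set0Pn[x xh] := hT0; have : x \in cover rho by rewrite (cover_partition pr).
by case/bigcupP => D' D'r _; rewrite -(blk _ D'r).
Qed.

End Restriction.

(** * Connected edge lists and spanning trees *)

Section SpanningTreeBound.
Context (R : realType) (V : finType) (K : wgraph R V).
Implicit Types (s : seq (V * V)) (Q : {set V}) (F : {set {set V}}).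

(** Connectedness by the absence of cuts: it passes to images and to
    concatenations of lists of edges without handling paths. *)
Definition closed_under s Q := forall e, e \in s -> (e.1 \in Q) = (e.2 \in Q).
Definition connects s := forall Q, closed_under s Q -> Q = set0 \/ Q = setT.
(** A degenerate edge, produced by projecting an edge with both ends in the same
    fiber, counts for 1. *)
Definition pair_weight (e : V * V) : R :=
  if e.1 == e.2 then 1 else weight K e.1 e.2.

Lemma edge_weight_itv e : e \in edge_set K -> 0 <= edge_weight K e <= 1.
Proof.
case/imset2P => x y _; rewrite inE => /andP[_ xy] ->.
by rewrite edge_weightE //; exact: weight_itv.
Qed.

Lemma max_tree_weight_ge0 : 0 <= max_tree_weight K.
Proof. exact: bigmax_ge_id. Qed.

Lemma subgraph_rel_sym F : symmetric (subgraph_rel F).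
Proof. by move=> x y; rewrite /subgraph_rel /= eq_sym setUC. Qed.

(** The rest of a cycle is a detour around any of its edges. *)
Lemma connect_drop_edge F x y q : (0 < size q)%N ->
  ucycleb (subgraph_rel F) (x :: y :: q) ->
  subrel (connect (subgraph_rel F)) (connect (subgraph_rel (F :\ [set x; y]))).
Proof.
case: q => // z q _ /= /andP[/and3P[xy yz pz] /and3P[]].
rewrite !inE !negb_or => /and3P[nxy nxz xq] /andP[nyz yq] _.
set F' := F :\ _; have F'E a b : a != b -> a \notin [set x; y] ->
    subgraph_rel F a b -> subgraph_rel F' a b.
  move=> ab axy /andP[_ abF]; rewrite /subgraph_rel /= ab !inE abF andbT.
  by apply: contra axy => /eqP <-; rewrite !inE eqxx.
have cyx : connect (subgraph_rel F') y x.
  apply/connectP; exists (z :: rcons q x); last by rewrite /= last_rcons.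
  apply/andP; split.
    rewrite subgraph_rel_sym; apply: F'E.
    - by rewrite eq_sym.
    - by rewrite !inE negb_or eq_sym nxz eq_sym nyz.
    - by rewrite subgraph_rel_sym.
  (* After its first step the detour avoids [y], hence the removed edge. *)
  apply: (@sub_in_path _ (fun a => a != y)) pz; last first.
    apply/allP => a; rewrite !inE mem_rcons inE => /or3P[/eqP->|/eqP->|aq].
    - by rewrite eq_sym.
    - by [].
    - by apply: contraNneq yq => <-.
  move=> a b ay b_y; have [ax|ax] := eqVneq a x; last first.
    by move=> ab; apply: F'E => //; [case/andP: ab|rewrite !inE negb_or ax].
  move=> ab; rewrite subgraph_rel_sym; apply: F'E.
  - by case/andP: ab => h _; rewrite eq_sym.
  - case/andP: ab => h _; rewrite !inE negb_or -{1}ax eq_sym h /=.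
    exact: b_y.
  - by rewrite subgraph_rel_sym.
have cxy : connect (subgraph_rel F') x y.
  by rewrite (sym_connect_sym (@subgraph_rel_sym F')).
apply: connect_sub => a b ab; have [/setP E|E] := eqVneq [set a; b] [set x; y].
  have := E a; rewrite !inE eqxx /= => /esym/orP.
  have := E b; rewrite !inE eqxx orbT /= => /esym/orP.
  by case=> /eqP-> [] /eqP->.
by apply: connect1; case/andP: ab => ab abF; rewrite /subgraph_rel /= ab !inE E.
Qed.

(** A minimal connected subset of [F] has no cycle by [connect_drop_edge], so it
    is a spanning tree; the edges dropped have weight at most 1. *)
Lemma prod_connected_le F : F \subset edge_set K ->
  (forall x y, connect (subgraph_rel F) x y) ->
  \prod_(e in F) edge_weight K e <= max_tree_weight K.
Proof.
move=> FK cF; pose pr (G : {set {set V}}) :=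
  [forall x, forall y, connect (subgraph_rel G) x y].
have prF : pr F by apply/forallP => x; apply/forallP.
have [G /minsetP[prG minG] GF] := minset_exists prF.
have GK := subset_trans GF FK.
have tG : spanning_tree K G.
  split=> //; first by move=> x y; move/forallP/(_ x)/forallP/(_ y): prG.
  case=> [|x [|y q]] // sz; apply/negP => cyc.
  have xyG : [set x; y] \in G.
    by have /andP[/= /andP[/andP[]]] := cyc.
  have /setP/(_ [set x; y]) : G :\ [set x; y] = G.
    apply: minG; last exact: subD1set.
    apply/forallP => a; apply/forallP => b; apply: (connect_drop_edge _ cyc) => //.
    by move/forallP/(_ a)/forallP/(_ b): prG.
  by rewrite !inE eqxx xyG.
apply: (@le_trans _ _ (\prod_(e in G) edge_weight K e)).
  rewrite [leLHS](big_setID G) /= (setIidPr GF) ler_piMr //.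
    by apply: prodr_ge0 => e eG; have /andP[] := edge_weight_itv (subsetP GK e eG).
  apply: prodr_ile1 => e; rewrite inE => /andP[_ eF].
  exact: edge_weight_itv (subsetP FK e eF).
by apply: (bigmax_sup G) => //; apply/asboolP.
Qed.

(** Repetitions and degenerate edges only decrease the product, as all weights
    are at most 1. *)
Lemma prod_connects_le s :
  (forall e, e \in s -> e.1 != e.2 -> edge K e.1 e.2) -> connects s ->
  \prod_(e <- s) pair_weight e <= max_tree_weight K.
Proof.
move=> sK cs.
pose E (t : seq (V * V)) := [set F | F \in [seq [set e.1; e.2] | e <- t & e.1 != e.2]].
have EK t : {subset t <= s} -> E t \subset edge_set K.
  move=> ts; apply/subsetP => F; rewrite inE => /mapP[e]; rewrite mem_filter.
  case/andP=> ne /ts es ->; apply/imset2P; exists e.1 e.2 => //.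
  by rewrite inE sK.
apply: (@le_trans _ _ (\prod_(F in E s) edge_weight K F)).
  have : {subset s <= s} by [].
  elim: {1 3 4}s => [|e t IH] ts.
    rewrite big_nil big_pred0 // => F; by rewrite inE.
  have tss : {subset t <= s} by move=> x xt; apply: ts; rewrite inE xt orbT.
  rewrite big_cons /pair_weight; have [ee|ee] := eqVneq e.1 e.2.
    rewrite mul1r (_ : E (e :: t) = E t) ?IH //.
    by apply/setP => F; rewrite !inE /= ee eqxx.
  have eK : edge K e.1 e.2 by rewrite sK // ts // mem_head.
  have EE : E (e :: t) = [set e.1; e.2] |: E t.
    by apply/setP => F; rewrite !inE /= ee inE.
  have /andP[w0 w1] := weight_itv eK.
  have P0 : 0 <= \prod_(F in E t) edge_weight K F.
    apply: prodr_ge0 => F Ft.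
    by have /andP[] := edge_weight_itv (subsetP (EK t tss) F Ft).
  have [eE|eE] := boolP ([set e.1; e.2] \in E t).
    rewrite EE (setUidPr _) ?sub1set //.
    by rewrite (le_trans (ler_wpM2l w0 (IH tss))) // ler_piMl.
  by rewrite EE big_setU1 //= edge_weightE // ler_wpM2l ?IH.
apply: prod_connected_le; first exact: EK.
move=> x y; pose Q := [set z | connect (subgraph_rel (E s)) x z].
have [||QT] := cs Q.
- move=> e es; have [->//|ne] := eqVneq e.1 e.2; rewrite !inE.
  have eE : subgraph_rel (E s) e.1 e.2.
    rewrite /subgraph_rel /= ne inE; apply/mapP; exists e => //.
    by rewrite mem_filter ne.
  exact: (same_connect1r (sym_connect_sym (@subgraph_rel_sym _)) eE).
- by move/setP/(_ x); rewrite !inE connect0.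
- by have := in_setT y; rewrite -QT inE.
Qed.

Lemma spanning_tree_connects F : spanning_tree K F ->
  exists s, [/\ forall e, e \in s -> edge K e.1 e.2, connects s &
    \prod_(e in F) edge_weight K e = \prod_(e <- s) weight K e.1 e.2].
Proof.
case=> FK cF _.
have [s [sF sK sw]] : exists s, [/\ [seq [set e.1; e.2] | e <- s] = enum F,
    forall e, e \in s -> edge K e.1 e.2 &
    \prod_(e <- enum F) edge_weight K e = \prod_(e <- s) weight K e.1 e.2].
  have : {subset enum F <= edge_set K}.
    by move=> e; rewrite mem_enum; apply: (subsetP FK).
  elim: (enum F) => [|e l IH] lK; first by exists [::]; rewrite !big_nil.
  have [|s [sl sK sw]] := IH; first by move=> x xl; apply: lK; rewrite inE xl orbT.
  have /imset2P[x y _] := lK e (mem_head _ _); rewrite inE => /andP[_ xy] eE.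
  exists ((x, y) :: s); split; first by rewrite /= sl eE.
    by move=> f; rewrite inE => /predU1P[->|/sK].
  by rewrite !big_cons sw eE edge_weightE.
exists s; split=> //; last by rewrite -sw big_enum.
move=> Q Qs.
have Qr : fingraph.closed (subgraph_rel F) (mem Q).
  move=> x y /andP[_]; rewrite -mem_enum -sF => /mapP[e /Qs Qe /setP E].
  have := E x; rewrite !inE eqxx /= => /esym/orP hx.
  have := E y; rewrite !inE eqxx orbT /= => /esym/orP hy.
  by case: hx hy => /eqP-> [] /eqP-> //; rewrite -topredE /= Qe.
have [->|/set0Pn[x xQ]] := eqVneq Q set0; [by left|right].
apply/setP => y; rewrite in_setT; have := closed_connect Qr (cF x y).
by move=> <-.
Qed.

Lemma max_tree_weight_attained : max_tree_weight K = 0 \/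
  exists2 F, spanning_tree K F &
    max_tree_weight K = \prod_(e in F) edge_weight K e.
Proof.
rewrite /max_tree_weight; elim/big_ind: _ => [|x y Hx Hy|F /asboolP tF]; first by left.
  by rewrite maxEle; case: ifP.
by right; exists F.
Qed.

End SpanningTreeBound.

(** Projects an optimal spanning tree of [K'] along [g]. *)
Lemma tree_image (R : realType) (V' V : finType) (K' : wgraph R V')
    (K : wgraph R V) (g : V' -> V) :
  (forall x y, edge K' x y -> g x != g y ->
     edge K (g x) (g y) /\ weight K' x y <= weight K (g x) (g y)) ->
  max_tree_weight K' = 0 \/ exists s : seq (V * V),
  [/\ forall e, e \in s -> e.1 != e.2 -> edge K e.1 e.2,
      max_tree_weight K' <= \prod_(e <- s) pair_weight K e &
      forall Q, closed_under s Q -> g @^-1: Q = set0 \/ g @^-1: Q = setT].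
Proof.
move=> gK; have [|[F /spanning_tree_connects[s [sK cs ws] ->]]] :=
  max_tree_weight_attained K'.
  by left.
right; exists [seq (g e.1, g e.2) | e <- s]; split.
- by move=> _ /mapP[e /sK es ->] /= /(gK _ _ es)[].
- rewrite ws big_map big_seq [leRHS]big_seq; apply: ler_prod => e /sK es.
  have /andP[-> w1] /= := weight_itv es.
  by rewrite /pair_weight /=; case: eqVneq => // /(gK _ _ es)[].
- move=> Q Qs; apply: cs => e es; rewrite !inE.
  by apply: (Qs (g e.1, g e.2)); apply/mapP; exists e.
Qed.

(** If one of the graphs has no spanning tree the left-hand side is 0.  Otherwise
    the projections of optimal trees of all the graphs form together a connected
    list of edges of [K]. *)
Lemma prod_max_tree_weight_le (R : realType) (V : finType) (K : wgraph R V)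
    (X : eqType) (l : seq X) (T : X -> finType) (K' : forall x, wgraph R (T x))
    (g : forall x, T x -> V) :
  (forall x a b, edge (K' x) a b -> g x a != g x b ->
     edge K (g x a) (g x b) /\ weight (K' x) a b <= weight K (g x a) (g x b)) ->
  (forall Q : {set V},
     (forall x, x \in l -> g x @^-1: Q = set0 \/ g x @^-1: Q = setT) ->
     Q = set0 \/ Q = setT) ->
  \prod_(x <- l) max_tree_weight (K' x) <= max_tree_weight K.
Proof.
move=> gK cl.
have [->|[s [sK ws cs]]] : \prod_(x <- l) max_tree_weight (K' x) = 0 \/
    exists s : seq (V * V),
  [/\ forall e, e \in s -> e.1 != e.2 -> edge K e.1 e.2,
      \prod_(x <- l) max_tree_weight (K' x) <= \prod_(e <- s) pair_weight K e &
      forall Q, closed_under s Q -> forall x, x \in l ->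
        g x @^-1: Q = set0 \/ g x @^-1: Q = setT].
- elim: {cl}l => [|x l IH].
    by right; exists [::]; split; rewrite ?big_nil.
  rewrite big_cons; have [->|[s [sK ws cs]]] := tree_image (gK x).
    by left; rewrite mul0r.
  case: IH => [->|[t [tK wt ct]]]; first by left; rewrite mulr0.
  right; exists (s ++ t); split.
  + by move=> e; rewrite mem_cat => /orP[/sK|/tK].
  + rewrite big_cat /= ler_pM ?max_tree_weight_ge0 //.
    by apply: prodr_ge0 => y _; apply: max_tree_weight_ge0.
  + move=> Q Qst y; rewrite inE => /predU1P[->|yl].
      by apply: cs => e es; apply: Qst; rewrite mem_cat es.
    by apply: ct => // e es; apply: Qst; rewrite mem_cat es orbT.
- exact: max_tree_weight_ge0.
- by apply: le_trans ws _; apply: prod_connects_le => // Q /cs/cl.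
Qed.

(** * Multisets of labels *)

Lemma perm_map_lift (X Y : eqType) (f : X -> Y) s t :
  perm_eq s (map f t) -> exists2 t', perm_eq t' t & s = map f t'.
Proof.
elim: s t => [|a s IH] t st.
  exists [::] => //; have := perm_size st; rewrite size_map /=.
  by move/esym/size0nil=> ->.
have /mapP[x xt ax] : a \in map f t by rewrite -(perm_mem st) mem_head.
have pt := perm_to_rem xt.
have : perm_eq s (map f (rem x t)).
  by rewrite -(perm_cons a) (permPl st) ax -map_cons perm_map.
case/IH => t' pt' ->; exists (x :: t'); last by rewrite /= ax.
by rewrite perm_sym (perm_trans pt) // perm_cons perm_sym.
Qed.

Section Labels.
Context (I : finType) (A : choiceType) (lab : I -> A).

Definition label_mset (D : {set I}) : {mset A} := seq_mset [seq lab x | x <- enum D].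

Lemma label_msetE D a : label_mset D a = (\sum_(x in D) (lab x == a))%N.
Proof.
by rewrite /label_mset mset_seqE count_map -sum1_count big_mkcond /= big_enum.
Qed.

Lemma size_label_mset D : mset_size (label_mset D) = #|D|.
Proof.
by rewrite /mset_size (perm_size (perm_eq_seq_mset _)) size_map -cardE.
Qed.

Lemma label_mset_neq0 D : D != set0 -> label_mset D != mset0.
Proof.
rewrite -card_gt0 -size_label_mset; apply: contraTneq => ->.
by rewrite /mset_size enum_mset0.
Qed.

(** [mset_cumulant] indexes variables by positions in the enumeration of a
    multiset, which groups equal labels in an order of its own; [h] translates
    these positions back into elements of [D]. *)
Lemma label_mset_enum D : exists h : 'I_(mset_size (label_mset D)) -> I,
  [/\ injective h, h @: setT = D & forall i, lab (h i) = mset_nth i].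
Proof.
have [t pt et] := perm_map_lift (perm_eq_seq_mset [seq lab x | x <- enum D]).
have st : size t == mset_size (label_mset D).
  by rewrite size_label_mset (perm_size pt) -cardE.
have ut : uniq t by rewrite (perm_uniq pt) enum_uniq.
exists (tnth (Tuple st)); split.
- by apply/tuple_uniqP.
- apply/setP => x; rewrite -[RHS]mem_enum -(perm_mem pt).
  by apply/imsetP/(tnthP (Tuple st)) => [[i _ ->]|[i ->]]; exists i.
- move=> i; pose x := tnth (Tuple st) i.
  rewrite /mset_nth (tnth_nth (lab x)) /= -/x.
  transitivity (nth (lab x) (map lab t) i); last by rewrite -et.
  by rewrite (nth_map x) ?(eqP st) // /x {1}(tnth_nth x).
Qed.

End Labels.

Lemma big_msetDE (A : choiceType) (X : Type) (l : seq X) (P : pred X)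
    (F : X -> {mset A}) a :
  (\big[msetD/mset0]_(x <- l | P x) F x) a = (\sum_(x <- l | P x) F x a)%N.
Proof.
apply: (big_morph (fun B : {mset A} => B a)) => [B B'|]; last exact: mset0E.
by rewrite msetE2.
Qed.

Lemma label_mset_partition (I : finType) (A : choiceType) (lab : I -> A) rho :
  partition rho [set: I] ->
  \big[msetD/mset0]_(D <- enum rho) label_mset lab D = label_mset lab setT.
Proof.
move=> pr; apply/msetP => a; rewrite big_msetDE label_msetE big_enum /=.
by rewrite (set_partition_big _ pr) /=; apply: eq_bigr => D _; rewrite label_msetE.
Qed.

Lemma super_multiplicative_prod (R : realType) (A : finType) (Psi : {mset A} -> R)
    (X : eqType) (l : seq X) (F : X -> {mset A}) :
  (forall B, B != mset0 -> 0 <= Psi B) -> super_multiplicative Psi ->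
  (0 < size l)%N -> (forall x, x \in l -> F x != mset0) ->
  \prod_(x <- l) Psi (F x) <= Psi (\big[msetD/mset0]_(x <- l) F x).
Proof.
move=> Psi0 sPsi; elim: l => // x [|y l] IH _ lF.
  by rewrite !big_cons !big_nil mulr1 msetD0.
have lF' z : z \in y :: l -> F z != mset0 by move=> zl; rewrite lF // inE zl orbT.
rewrite big_cons [X in _ <= Psi X]big_cons (le_trans _ (sPsi _ _ _ _)) ?lF ?mem_head //.
  by rewrite ler_wpM2l ?IH // Psi0 // lF ?mem_head.
apply: contraNneq (lF' y (mem_head _ _)) => /msetP E; apply/eqP/msetP => b.
have := E b; rewrite big_cons msetE2 mset0E => /eqP; rewrite addn_eq0.
by case/andP => /eqP.
Qed.

(** * Finite moments of products *)

Section FiniteMoments.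
Context d (T : measurableType d) (R : realType) (P : probability T R).
Implicit Types X Y : {RV P >-> R}.

(** [|x y|] is at most [x^2 + y^2], so the [n]-th moment of the product is
    controlled by the moments of order [2 n] of the factors. *)
Lemma has_finite_momentsM X Y : has_finite_moments X -> has_finite_moments Y ->
  @has_finite_moments _ _ _ P ((X : {mfun T >-> R}) * (Y : {mfun T >-> R})).
Proof.
move=> iX iY n.
apply: (@le_integrable _ _ _ P _ measurableT _
  (fun t => (X t ^+ (2 * n))%R%:E + (Y t ^+ (2 * n))%R%:E)%E) => //.
- by apply/measurable_EFinP; apply: measurable_funX; exact: measurable_funPT.
- move=> t _ /=; rewrite lee_fin exprMn !exprM -!(exprM _ 2) !(mulnC 2%N) !exprM.
  move: (X t ^+ n) (Y t ^+ n) => x y.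
  rewrite [leRHS]ger0_norm ?addr_ge0 ?sqr_ge0 // ler_norml.
  have := sqr_ge0 (x + y); have := sqr_ge0 (x - y).
  have := sqr_ge0 x; have := sqr_ge0 y.
  by move=> *; apply/andP; split; nra.
- by apply: integrableD => //; [exact: iX|exact: iY].
Qed.

Lemma has_finite_moments1 : @has_finite_moments _ _ _ P (1 : {mfun T >-> R}).
Proof.
move=> n; rewrite (_ : EFin \o _ = cst 1%:E).
  by apply: finite_measure_integrable_cst.
by apply/funext => t /=; rewrite expr1n.
Qed.

End FiniteMoments.

(** * Cumulants of products of variables *)

Section ProductFamily.
Context d (T : measurableType d) (R : realType) (P : probability T R).
Context (A : finType) (Y : A -> {RV P >-> R}).

Lemma has_finite_moments_mset_product m (J : mset_le m A) :
  (forall a, has_finite_moments (Y a)) -> has_finite_moments (mset_product Y J).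
Proof.
move=> Ym; rewrite /mset_product; elim: (enum_mset J) => [|a l IH].
  by rewrite big_nil; exact: has_finite_moments1.
by rewrite big_cons; apply: has_finite_momentsM.
Qed.

Definition joint_moment (I : finType) (lab : I -> A) (S : {set I}) : R :=
  fine 'E_P[\prod_(x in S) (Y (lab x) : {mfun T >-> R})]%E.

Lemma joint_moment0 (I : finType) (lab : I -> A) : joint_moment lab set0 = 1.
Proof.
by rewrite /joint_moment big_set0; have -> := @expectation_cst _ _ _ P 1.
Qed.

(** [cumulant_cluster] along an enumeration of [D]: the signed sum of products of
    moments inverts [cluster_sum]. *)
Lemma mset_cumulant_block (I : finType) (lab : I -> A) (k : {set I} -> R) D :
  (forall S, joint_moment lab S = cluster_sum k S) -> D != set0 ->
  mset_cumulant Y (label_mset lab D) = k D.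
Proof.
move=> kM D0; have [h [h_inj hT hlab]] := label_mset_enum lab D.
rewrite -[in RHS]hT -cumulant_cluster //; last first.
  by rewrite card_ord size_label_mset card_gt0.
rewrite /mset_cumulant /joint_cumulant /moebius.
apply: eq_bigr => pi _; congr (_ * _); apply: eq_bigr => S _.
rewrite -kM; congr (fine 'E_P[_]%E); apply: congr1.
rewrite big_imset /=; last exact: in2W.
by apply: eq_bigr => i _; rewrite hlab.
Qed.

Section Power.
Context (m : nat) (B : {mset mset_le m A}).

(** Members of [B] may repeat and overlap, so an index has to remember its member
    of [B] and its position there. *)
Definition copies : finType :=
  {j : 'I_(mset_size B) & 'I_(mset_size (mset_of_le (mset_nth j)))}.
Definition copy j i : copies := existT _ j i.
Definition copy_label (x : copies) : A := mset_nth (tagged x).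
Definition copy_owner (x : copies) : option 'I_(mset_size B) := Some (tag x).

(** [grouped_cumulant] along the map sending a copy to the member of [B] that it
    comes from. *)
Lemma mset_cumulant_product (k : {set copies} -> R) : (0 < mset_size B)%N ->
  (forall S, joint_moment copy_label S = cluster_sum k S) ->
  mset_cumulant (@mset_product _ _ _ _ _ Y m) B =
  \sum_(rho : {set {set copies}} | partition rho setT &&
      connected_by [set oimg copy_owner D | D in rho])
    \prod_(D in rho) k D.
Proof.
move=> r0 kM; have opreimT : opreim copy_owner setT = setT.
  by apply/setP => x; rewrite inE /= !inE.
rewrite -{1}opreimT -grouped_cumulant ?card_ord //.
rewrite /mset_cumulant /joint_cumulant /moebius.
apply: eq_bigr => pi _; congr (_ * _); apply: eq_bigr => S _.
rewrite -kM; congr (fine 'E_P[_]%E); apply: congr1; rewrite /mset_product.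
transitivity (\prod_(j in S) \prod_(i < mset_size (mset_of_le (mset_nth j)))
    (Y (copy_label (copy i)) : {mfun T >-> R})).
  by apply: eq_bigr => j _; rewrite big_tnth.
rewrite sig_big_dep /=; apply: eq_big => [x|[j i] _ //].
by rewrite inE andbT.
Qed.

Lemma copy_label_mset :
  label_mset copy_label setT = \big[msetD/mset0]_(J <- enum_mset B) mset_of_le J.
Proof.
apply/msetP => a; rewrite label_msetE big_msetDE [RHS]big_tnth.
transitivity (\sum_(x : copies | true && true) (copy_label x == a))%N.
  by apply: eq_bigl => x; rewrite inE.
rewrite -(sig_big_dep (fun=> true) (fun=> predT)
  (fun j i => nat_of_bool (copy_label (@copy j i) == a))) /=.
apply: eq_bigr => j _.
rewrite -count_mem_mset -sum1_count [RHS]big_mkcond [RHS]big_tnth /=.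
by apply: eq_bigr => i _; rewrite /copy_label /mset_nth /=; case: eqP.
Qed.

Lemma card_copies : (#|copies| <= m * mset_size B)%N.
Proof.
rewrite card_tagged sumnE big_map big_enum /=.
rewrite -[X in (_ <= _ * X)%N]card_ord mulnC -sum_nat_const; apply: leq_sum => j _.
by rewrite card_ord; have /andP[] := mset_le_size (mset_nth j).
Qed.

(** Let the ends be copies of [a] and [a'].  Either [a = a'], and then the two
    members of [B] meet and their weight is 1, or the weight of the edge between
    [a] and [a'] enters the maximum defining the weight between the members. *)
Lemma copies_edge (L : wgraph R A) (D : {set copies})
    (h : 'I_(mset_size (label_mset copy_label D)) -> copies) :
  (forall i, copy_label (h i) = mset_nth i) -> forall x y,
  edge (induced_wgraph L (label_mset copy_label D)) x y -> tag (h x) != tag (h y) ->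
  edge (induced_wgraph (power_wgraph L m) B) (tag (h x)) (tag (h y)) /\
  weight (induced_wgraph L (label_mset copy_label D)) x y <=
  weight (induced_wgraph (power_wgraph L m) B) (tag (h x)) (tag (h y)).
Proof.
move=> hlab x y xy hxy; have /andP[_ w1] := weight_itv xy.
move: xy w1; rewrite /= /induced_edge /induced_weight /= -!hlab hxy /=.
move: (h x) (h y) hxy => [j i] [j' i'] /= _ /andP[_].
rewrite /copy_label /=; set a := mset_nth i; set a' := mset_nth i'.
have aj : a \in mset_of_le (mset_nth j) by exact: mem_tnth.
have aj' : a' \in mset_of_le (mset_nth j') by exact: mem_tnth.
case: (eqVneq (mset_nth j) (mset_nth j')) => [//|jj] /=.
rewrite /power_edge /power_weight /= jj /= /mset_linked /mset_weight => aa w1.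
case: (boolP (mdisjoint _ _)) => dj /=; last by split.
have {}aa : (a == a') = false /\ edge L a a'.
  case: eqVneq aa => //= aa _; move/eqP/msetP/(_ a): dj.
  rewrite msetE2 mset0E => /eqP; rewrite -leqn0 geq_min !leqn0 !mset_eq0.
  by rewrite aj aa aj'.
case: aa w1 => -> aa w1; split.
  by apply/exists_inP; exists a => //; apply/exists_inP; exists a'.
apply: (bigmax_sup a) => //.
by apply: (bigmax_sup a') => //; rewrite aj'.
Qed.

(** A set of members of [B] closed under the projected trees contains or avoids
    the image of each block of [rho], since each tree spans its block; as [rho]
    connects the members of [B], the set is empty or everything. *)
Lemma prod_block_tree_weight (L : wgraph R A) (rho : {set {set copies}}) :
  connected_by [set oimg copy_owner D | D in rho] ->
  \prod_(D in rho)
    max_tree_weight (induced_wgraph L (label_mset copy_label D)) <=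
  max_tree_weight (induced_wgraph (power_wgraph L m) B).
Proof.
move=> cr; pose h D := projT1 (cid (label_mset_enum copy_label D)).
have hP D : [/\ injective (h D), h D @: setT = D &
  forall i, copy_label (h D i) = mset_nth i].
  exact: projT2 (cid (label_mset_enum copy_label D)).
rewrite -big_enum; apply: (prod_max_tree_weight_le (g := fun D x => tag (h D x))).
  by move=> D; have [_ _ hl] := hP D; apply: copies_edge.
move=> Q cQ; have /forallP/(_ Q) := cr; rewrite [X in X ==> _](_ : _ = true).
  by case/orP => /eqP; [left|right].
apply/forall_inP => _ /imsetP[D Dr ->]; have [_ hT _] := hP D.
have mem_img j : j \in oimg copy_owner D ->
    exists i, j = tag (h D i).
  rewrite inE => /exists_inP[x]; rewrite -{1}hT => /imsetP[i _ ->] /eqP[<-].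
  by exists i.
have [|E|E] := cQ D; first by rewrite mem_enum.
  apply/orP; right; rewrite disjoint_subset; apply/subsetP => _ /mem_img[i ->].
  by have /setP/(_ i) := E; rewrite !inE => ->.
apply/orP; left; apply/subsetP => _ /mem_img[i ->].
by have /setP/(_ i) := E; rewrite !inE.
Qed.

End Power.
End ProductFamily.

(** * The bound for the power graph *)

Lemma card_set_partition (I : finType) (rho : {set {set I}}) S :
  partition rho S -> (#|rho| <= #|S|)%N.
Proof.
move=> pr; rewrite (card_partition pr) -sum1_card; apply: leq_sum => D Dr.
by rewrite card_gt0 (partition_neq0 pr Dr).
Qed.

Lemma card_sets_of_sets (I : finType) (n : nat) (p : pred {set {set I}}) :
  (#|I| <= n)%N -> (#|p| <= 2 ^ 2 ^ n)%N.
Proof.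
move=> In; apply: leq_trans (max_card _) _.
have card_sets (X : finType) : #|{set X}| = (2 ^ #|X|)%N.
  by rewrite -[#|X|]cardsT -card_powerset powersetT cardsT.
by rewrite !card_sets !leq_exp2l.
Qed.

(** The base bounds every [C_i] with [1 <= i <= m r] as well as 1, and a partition
    of at most [m r] points has at most [m r] blocks; the last factor bounds the
    number of partitions. *)
Definition power_constant (R : realType) (m r : nat) (c : (m * r).-tuple R) : R :=
  (1 + \sum_i tnth c i) ^+ (m * r) * (2 ^ 2 ^ (m * r))%N%:R.

Theorem proposition5p11 (R : realType) (m : nat) (m_gt0 : (0 < m)%N) :
  exists D : forall r : nat, (m * r).-tuple R -> R,
    (forall (r : nat) (c : (m * r).-tuple R), (0 < r)%N ->
       (forall i, 0 < tnth c i) -> 0 < D r c) /\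
    forall (d : measure_display) (T : measurableType d) (P : probability T R)
      (A : finType) (Y : A -> {RV P >-> R}) (L : wgraph R A)
      (Psi : {mset A} -> R) (C : nat -> R),
      (forall r : nat, (0 < r)%N -> 0 < C r) ->
      (forall B : {mset A}, B != mset0 -> 0 <= Psi B) ->
      super_multiplicative Psi ->
      weighted_dependency_graph Psi C Y L ->
      weighted_dependency_graph
        (@bold_Psi R A Psi m)
        (fun r : nat => D r [tuple C i.+1 | i < m * r])
        (@mset_product d T R P A Y m)
        (power_wgraph L m).
Proof.
exists (@power_constant R m); split;
  last move=> d T P A Y L Psi C Cpos Psi0 sPsi [Ym Yk].
  move=> r c _ cpos; rewrite mulr_gt0 ?ltr0n ?expn_gt0 // exprn_gt0 // ltr_pwDl //.
  by apply: sumr_ge0 => i _; exact: ltW.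
split=> [J|B B0]; first exact: has_finite_moments_mset_product.
have r0 : (0 < mset_size B)%N.
  rewrite lt0n; apply: contra B0 => /eqP/size0nil B0.
  by rewrite -[B]seq_mset_id B0; apply/eqP/msetP => x; rewrite mset_seqE mset0E.
have copies0 : [set: copies B] != set0.
  have /andP[J0 _] := mset_le_size (mset_nth (Ordinal r0)).
  by apply/set0Pn; exists (copy (Ordinal J0)).
have [k kM] := cluster_sum_exists (joint_moment0 Y (@copy_label A m B)).
rewrite (mset_cumulant_product r0 kM) /power_constant.
set n := (m * mset_size B)%N; set c := [tuple _ | i < n]; set K := 1 + _.
have In : (#|copies B| <= n)%N := card_copies B.
have K1 : 1 <= K.
  by rewrite lerDl sumr_ge0 // => i _; rewrite tnth_mktuple ltW // Cpos.
have CK i : (0 < i <= n)%N -> C i <= K.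
  case: i => // i /= lt_in; rewrite /K (bigD1 (Ordinal lt_in)) //= tnth_mktuple /=.
  rewrite addrCA lerDl addr_ge0 ?sumr_ge0 // => j _.
  by rewrite tnth_mktuple ltW // Cpos.
set M := max_tree_weight _; set Psi' := bold_Psi Psi B.
have Psi'0 : 0 <= Psi'.
  by rewrite /Psi' /bold_Psi -copy_label_mset; apply/Psi0/label_mset_neq0.
have M0 : 0 <= M := max_tree_weight_ge0 _.
have bound (rho : {set {set copies B}}) :
    partition rho setT &&
      connected_by [set oimg (@copy_owner A m B) D | D in rho] ->
    `|\prod_(D in rho) k D| <= K ^+ n * Psi' * M.
  case/andP=> pr cr; have nz D : D \in rho -> D != set0 by exact: partition_neq0 pr.
  rewrite normr_prod.
  apply: (@le_trans _ _ (\prod_(D in rho) (K * Psi (label_mset (@copy_label A m B) D) *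
     max_tree_weight (induced_wgraph L (label_mset (@copy_label A m B) D))))).
    apply: ler_prod => D Dr; rewrite normr_ge0 /= -(mset_cumulant_block kM (nz D Dr)).
    apply: le_trans (Yk _ (label_mset_neq0 _ (nz D Dr))) _.
    rewrite ler_wpM2r ?max_tree_weight_ge0 // ler_wpM2r ?Psi0 ?label_mset_neq0 ?nz //.
    rewrite CK // size_label_mset card_gt0 nz //= (leq_trans _ In) //.
    exact: max_card.
  have Pr0 : 0 <= \prod_(D in rho) Psi (label_mset (@copy_label A m B) D).
    by apply: prodr_ge0 => D Dr; rewrite Psi0 ?label_mset_neq0 ?nz.
  rewrite !big_split /= prodr_const; apply: ler_pM.
  - by rewrite mulr_ge0 // exprn_ge0 // (le_trans ler01).
  - by apply: prodr_ge0 => D _; exact: max_tree_weight_ge0.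
  - apply: ler_pM => //; first by rewrite exprn_ge0 // (le_trans ler01).
      rewrite ler_weXn2l // (leq_trans (card_set_partition pr)) // cardsT //.
    rewrite /Psi' /bold_Psi -copy_label_mset -(label_mset_partition _ pr) -big_enum.
    apply: super_multiplicative_prod => // [|D]; last first.
      by rewrite mem_enum => /nz/label_mset_neq0.
    rewrite -cardE card_gt0; apply: contra copies0 => /eqP rho0.
    by rewrite -(cover_partition pr) rho0 /cover big_set0.
  - exact: prod_block_tree_weight.
apply: le_trans (ler_norm_sum _ _ _) _; apply: le_trans (ler_sum _ bound) _.
rewrite sumr_const -[leLHS]mulr_natl [K ^+ n * _%:R]mulrC -!mulrA ler_wpM2r //.
  by rewrite !mulr_ge0 // exprn_ge0 // (le_trans ler01).
by rewrite ler_nat; apply: card_sets_of_sets.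
Qed.
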